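(* One has $\|q_0\|=1$ and $\|q_i\|=-1$ for $1\le i\le l-1$. As a consequence, the space $G/H$ (with the $G$-invariant metric induced by $\|\cdot\|$ on $\mathfrak q\cong T_{[e]}(G/H)$) is Lorentzian.
   Context: Let $l\ge 3$. Here $SO(p,q)$ denotes the identity component of the special orthogonal group of signature $(p,q)$. Let $G=SO(2,l-1)$ act on $\mathbb R^{2,l-1}$ (two positive and $l-1$ negative directions), let $H=SO(1,l-1)\subset G$ be the stabilizer of a vector of square norm $+1$, let $\mathfrak g,\mathfrak h$ be their Lie algebras and let $B$ be the Killing form of $\mathfrak g$. Let $\sigma$ be the involutive automorphism of $\mathfrak g$ whose $+1$-eigenspace is $\mathfrak h$, and let $\mathfrak q$ be its $-1$-eigenspace. Let $\theta$ be a Cartan involution of $\mathfrak g$ commuting with $\sigma$, with $+1$-eigenspace $\mathfrak k$ and $-1$-eigenspace $\mathfrak p$. Let $\mathfrak a\subset\mathfrak p$ be a maximal abelian subalgebra with a basis $J_1\in\mathfrak h$, $J_2\in\mathfrak q$, normalized so that, writing $\mathfrak g_{(\alpha,\beta)}=\{X\in\mathfrak g:[J_1,X]=\alpha X,\ [J_2,X]=\beta X\}$, the restricted roots are $(\pm1,\pm1)$ (four roots, each of multiplicity one) and, if $l\ge4$, $(\pm1,0),(0,\pm1)$ (each of multiplicity $l-3$). Choose $X_{++}\in\mathfrak g_{(1,1)}$ with $[\theta X_{++},X_{++}]=4(J_1+J_2)$, and a basis $X^k_{0+}$ ($3\le k\le l-1$) of $\mathfrak g_{(0,1)}$ with $[\theta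 X^k_{0+},X^k_{0+}]=2J_2$ and $B(X^j_{0+},\theta X^k_{0+})=0$ for $j\neq k$. Put $q_0=\tfrac14(X_{++}-\sigma X_{++}+\theta X_{++}-\sigma\theta X_{++})$, $q_1=J_2$, $q_2=-[J_1,q_0]$, and $q_k=\tfrac12(X^k_{0+}-\theta X^k_{0+})$ for $3\le k\le l-1$; these are elements of $\mathfrak q$. The ''norm'' of $X\in\mathfrak g$ is the (indefinite, quadratic) quantity $\|X\|=-\frac{1}{2(l-1)}B(X,X)$. Lorentzian means that the metric has signature $(1,l-1)$. *)

(* Defs.v *)
From HB Require Import structures.
From mathcomp Require Import all_boot all_order all_algebra.
From mathcomp Require Import all_classical all_reals all_analysis.
Set Implicit Arguments.
Unset Strict Implicit.
Unset Printing Implicit Defensive.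
Import Order.TTheory GRing.Theory Num.Theory.
Import numFieldNormedType.Exports.
Local Open Scope classical_set_scope.
Local Open Scope ring_scope.

(* R^{2,l-1} is 'cV[R]_(l.+1) with the form of Gram matrix [gram], and all Lie
   algebras are subspaces of 'M[R]_(l.+1) under the matrix commutator. *)

Section LieAlgebra.
Variables (R : realType) (n : nat).
Implicit Types (X Y : 'M[R]_n) (g a p : {vspace 'M[R]_n}).

Definition lie X Y : 'M[R]_n := X *m Y - Y *m X.

Fact lie_linear X : linear (lie X).
Proof.
by move=> c Y Z; rewrite /lie linearP /= mulmxDl -scalemxAl scalerBr opprD
  addrACA.
Qed.
HB.instance Definition _ X :=
  GRing.isLinear.Build R 'M[R]_n 'M[R]_n _ (lie X) (lie_linear X).

(* Trace of [ad X \o ad Y] on g, read off in a basis of g. *)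
Definition killing g X Y : R :=
  \sum_(i < \dim g) coord (vbasis g) i (lie X (lie Y (vbasis g)`_i)).

(* s is given as an endomorphism of the ambient matrix space, but only its
   restriction to g matters; bijectivity on g follows from involutivity. *)
Definition involutive_lie_aut g (s : 'End('M[R]_n)) : Prop :=
  [/\ (s @: g <= g)%VS,
      {in g &, forall X Y, s (lie X Y) = lie (s X) (s Y)}
    & {in g, forall X, s (s X) = X}].

Definition cartan_involution g (t : 'End('M[R]_n)) : Prop :=
  involutive_lie_aut g t /\
  {in g, forall X, X != 0 -> 0 < - killing g X (t X)}.

Definition eigsub g (s : 'End('M[R]_n)) (c : R) : {vspace 'M[R]_n} :=
  (g :&: passmx.leigenspace s c)%VS.

Definition abelian_sub a : Prop := {in a &, forall X Y, lie X Y = 0}.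

Definition maximal_abelian_in p a : Prop :=
  [/\ (a <= p)%VS, abelian_sub a
    & forall b, (a <= b)%VS -> (b <= p)%VS -> abelian_sub b -> b = a].

Definition rootspace g (J1 J2 : 'M[R]_n) (x y : R) : {vspace 'M[R]_n} :=
  (eigsub g (linfun (lie J1)) x :&: eigsub g (linfun (lie J2)) y)%VS.

Definition Ad (u X : 'M[R]_n) : 'M[R]_n := u *m X *m invmx u.

Fact Ad_linear u : linear (Ad u).
Proof. by move=> c X Y; rewrite /Ad linearP /= mulmxDl -scalemxAl. Qed.
HB.instance Definition _ u :=
  GRing.isLinear.Build R 'M[R]_n 'M[R]_n _ (Ad u) (Ad_linear u).

(* The symmetric bilinear form b on g, having k in its radical, induces on the
   quotient g / k a nondegenerate form with r plus signs and s minus signs: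
   the classes of the e_i form an orthonormal basis of g / k. *)
Definition quotient_signature g (k : {vspace 'M[R]_n})
    (b : 'M[R]_n -> 'M[R]_n -> R) (r s : nat) : Prop :=
  exists e : (r + s).-tuple 'M[R]_n,
    [/\ free e, (<<e>> + k)%VS = g, (<<e>> :&: k)%VS = 0%VS
      & forall i j : 'I_(r + s), b e`_i e`_j =
          if i == j then (if (i < r)%N then 1 else -1) else 0].

End LieAlgebra.

Section Smooth.
Variables (R : realType) (n : nat).
Local Notation M := 'M[R]_n.+1.

(* f is of class C^k on the open set U: all iterated directional derivatives
   of order at most k exist and are continuous on U. *)
Fixpoint Ck_on (U : set M) (k : nat) (f : M -> R^o) : Prop :=
  (forall x, U x -> {for x, continuous f}) /\
  if k is k'.+1 then
    (forall x v, U x -> derivable f x v) /\ (forall v, Ck_on U k' ('D_v f))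
  else True.

(* Smooth functions on an embedded submanifold S of the space of matrices:
   near each point of S, f is the restriction of a C^oo function. *)
Definition smooth_on_sub (S : set M) (f : M -> R) : Prop :=
  forall x, S x -> exists (U : set M) (F : M -> R^o),
    [/\ open U, U x, forall k, Ck_on U k F & forall y, U y -> S y -> f y = F y].

End Smooth.

Section SO2.
Variables (R : realType) (l : nat).
Local Notation M := 'M[R]_l.+1.
Implicit Types (X Y : M) (v : 'cV[R]_l.+1).

(* diag(1, 1, -1, ..., -1) *)
Definition gram : M :=
  diag_mx (\row_(i < l.+1) (if (i < 2)%N then 1 else -1)).

Definition sqnorm v : R := (v^T *m gram *m v) 0 0.

Definition SOfull : set M := [set u | u^T *m gram *m u = gram /\ \det u = 1].

Definition G : set M := connected_component SOfull 1%:M.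

Definition H v : set M := [set u | G u /\ u *m v = v].

Definition so_eq X : M := X^T *m gram + gram *m X.

Fact so_eq_linear : linear so_eq.
Proof.
by move=> c X Y; rewrite /so_eq !linearP /= mulmxDl -scalemxAl scalerDr addrACA.
Qed.
HB.instance Definition _ := GRing.isLinear.Build R M M _ so_eq so_eq_linear.

(* The Lie algebra so(2,l-1) of G. *)
Definition lieG : {vspace M} := lker (linfun so_eq).

(* The Lie algebra of H v, the annihilator of v in that of G. *)
Definition lieH v : {vspace M} :=
  (lieG :&: lker (linfun (mulmxr v : M -> 'cV[R]_l.+1)))%VS.

Lemma lieGP X : (X \in lieG) = (X^T *m gram + gram *m X == 0).
Proof. by rewrite memv_ker lfunE. Qed.

Lemma lieHP v X : (X \in lieH v) = (X \in lieG) && (X *m v == 0).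
Proof. by rewrite memv_cap memv_ker lfunE. Qed.

(* The "norm" -B(X,X) / (2(l-1)), which is quadratic and indefinite. *)
Definition qnorm X : R := - (2 * (l - 1)%:R)^-1 * killing lieG X X.

(* A point of G/H is a coset, as a subset of G. *)
Definition lcoset v (u : M) : set M := [set u *m w | w in H v].

(* Pseudo-Riemannian G-invariant metrics on G/H inducing qnorm at [e].
   The infinitesimal action X |-> d/dt exp(tX).x at t = 0 identifies the
   tangent space of G/H at x = uH with g / Ad(u)h, where Ad(u)h is the Lie
   algebra of the stabilizer of x; the differential of x |-> w.x is then
   induced by Ad(w), and q is identified with the tangent space g / h at [e].
   A field of forms on the tangent spaces is hence a family m x of forms on g
   with Ad(u)h in the radical.  It is smooth when its values on the
   infinitesimal-action vector fields are, and a function on G/H is smooth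
   when its pull-back to G is.  The values of m at non-cosets, or at matrices
   outside g, are irrelevant.  Nondegeneracy is not required here: it is part
   of having signature (1,l-1). *)
Record invariant_metric v (q : {vspace M}) (m : set M -> M -> M -> R) : Prop :=
  InvariantMetric {
    im_linear : forall u, G u -> {in lieG & &, forall X Y Z c,
      m (lcoset v u) (c *: X + Y) Z
        = c * m (lcoset v u) X Z + m (lcoset v u) Y Z};
    im_sym : forall u, G u -> {in lieG &, forall X Y,
      m (lcoset v u) X Y = m (lcoset v u) Y X};
    im_descends : forall u, G u -> {in lieH v & lieG, forall X Y,
      m (lcoset v u) (Ad u X) Y = 0};
    im_smooth : {in lieG &, forall X Y,
      smooth_on_sub G (fun u => m (lcoset v u) X Y)};
    im_invariant : forall w u, G w -> G u -> {in lieG &, forall X Y,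
      m (lcoset v (w *m u)) (Ad w X) (Ad w Y) = m (lcoset v u) X Y};
    im_base : {in q, forall X, m (lcoset v 1%:M) X X = qnorm X} }.

Definition lorentzian v (m : set M -> M -> M -> R) : Prop :=
  forall u, G u ->
    quotient_signature lieG (linfun (Ad u) @: lieH v)%VS (m (lcoset v u))
      1%N (l - 1)%N.

(* Dimensions of the root spaces for (x, y) != (0, 0); dimension 0 means that
   (x, y) is not a restricted root. *)
Definition root_mult (x y : R) : nat :=
  if (x \in [:: 1; -1]) && (y \in [:: 1; -1]) then 1%N
  else if (x \in [:: 1; -1]) && (y == 0) || (x == 0) && (y \in [:: 1; -1])
  then (l - 3)%N else 0%N.

Definition q0vec (sigma theta : 'End(M)) (Xpp : M) : M :=
  4^-1 *: (Xpp - sigma Xpp + theta Xpp - sigma (theta Xpp)).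

(* q_0, ..., q_{l-1}; X0p k stands for X^k_{0+} and is used for k >= 3 only. *)
Definition qvec (sigma theta : 'End(M)) (J1 J2 Xpp : M) (X0p : nat -> M)
    (k : nat) : M :=
  match k with
  | 0%N => q0vec sigma theta Xpp
  | 1%N => J2
  | 2%N => - lie J1 (q0vec sigma theta Xpp)
  | _ => 2^-1 *: (X0p k - theta (X0p k))
  end.

End SO2.

Arguments gram : clear implicits.
Arguments G : clear implicits.
Arguments lieG : clear implicits.

(* Main.v *)
(* On g = so(2,l-1) the Killing form is (l-1) tr(XY).  An X in q is determined
   by its value w = X v in the orthogonal complement of v, namely
   X = <v,.> w - <w,.> v, so that tr(XY) = -2 <X v, Y v> for Y in g, and
   ||X|| = <X v, X v>.  Writing J_2 = <v,.> w - <w,.> v, the existence of an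
   eigenvector of ad J_2 with eigenvalue 1 forces <w,w> = -1; the norms of the
   other q_i follow from the invariance of the trace form, and root weights
   make the q_i orthogonal.  That q_k lies in q for k >= 3 amounts to
   sigma = theta on g_(0,1), and a failure of this would give a vector of
   positive norm in q orthogonal to q_0, against the signature of R^{2,l-1}.
   The invariant metric is the one induced on the orbit G v of R^{2,l-1}. *)
Require Import Defs.
From HB Require Import structures.
From mathcomp Require Import all_boot all_order all_algebra.
From mathcomp Require Import all_classical all_reals all_analysis.
From mathcomp Require Import ring lra zify.
Import Order.TTheory GRing.Theory Num.Theory.
Import numFieldNormedType.Exports.
Local Open Scope classical_set_scope.
Local Open Scope ring_scope.

Set Implicit Arguments.
Unset Strict Implicit.
Unset Printing Implicit Defensive.

(** * Traces of endomorphisms of a subspace of matrices *)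

Section TraceOnSubspace.
Variables (R : realType) (n : nat).
Local Notation M := 'M[R]_n.
Implicit Types (g : {vspace M}) (f h s t : M -> M) (X Y Z : M).

(** This is the trace of the restriction when [f] preserves [g]; otherwise the value depends on how
    [coord] acts on vectors outside [g]. *)
Definition trace_on g f : R :=
  \sum_(i < \dim g) coord (vbasis g) i (f (vbasis g)`_i).

Lemma vbasis_nth_mem g (i : 'I_(\dim g)) : (vbasis g)`_i \in g.
Proof. by apply: vbasis_mem; rewrite mem_nth // size_tuple. Qed.

Lemma killingE g X Y : killing g X Y = trace_on g (lie X \o lie Y).
Proof. by []. Qed.

Lemma eq_trace_on g f h : {in g, f =1 h} -> trace_on g f = trace_on g h.
Proof.
by move=> fh; apply: eq_bigr => i _; rewrite fh // vbasis_nth_mem.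
Qed.

Lemma trace_onC g (f h : {linear M -> M}) :
    {in g, forall X, f X \in g} -> {in g, forall X, h X \in g} ->
  trace_on g (f \o h) = trace_on g (h \o f).
Proof.
move=> fg hg.
(* Only the inner map has to preserve [g] here; the expansion is applied once in each order of
   composition. *)
have expand (f1 f2 : {linear M -> M}) : {in g, forall X, f2 X \in g} ->
    trace_on g (f1 \o f2) = \sum_(i < \dim g) \sum_(j < \dim g)
      coord (vbasis g) j (f2 (vbasis g)`_i)
        * coord (vbasis g) i (f1 (vbasis g)`_j).
  move=> f2g; apply: eq_bigr => i _ /=.
  rewrite {1}(coord_vbasis (f2g _ (vbasis_nth_mem i))) !linear_sum /=.
  by apply: eq_bigr => j _; rewrite !linearZ.
rewrite !expand // exchange_big /=.
by apply: eq_bigr => i _; apply: eq_bigr => j _; rewrite mulrC.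
Qed.

(** Composing [f] with a projection onto [g] keeps the trace and makes it computable in the
    elementary matrices of the ambient space. *)
Lemma trace_on_mxtrace g (p f : {linear M -> M}) :
    (forall Z, p Z \in g) -> {in g, forall Z, p Z = Z} ->
    {in g, forall Z, f Z \in g} ->
  trace_on g f = \sum_i \sum_j f (p (delta_mx i j)) i j.
Proof.
move=> pg pK fg; apply: esym.
transitivity (\sum_i \sum_j \sum_(k < \dim g)
    coord (vbasis g) k (p (delta_mx i j)) * f (vbasis g)`_k i j).
  apply: eq_bigr => i _; apply: eq_bigr => j _.
  rewrite {1}(coord_vbasis (pg (delta_mx i j))) linear_sum /= summxE.
  by apply: eq_bigr => k _; rewrite linearZ mxE.
under eq_bigr => i _ do rewrite exchange_big /=.
rewrite exchange_big /=; apply: eq_bigr => k _.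
(* The image of a basis vector is fixed by [p]; expanding it in elementary matrices inside [p]
   produces the double sum. *)
rewrite -[in RHS](pK _ (fg _ (vbasis_nth_mem k))).
rewrite {2}(matrix_sum_delta (f _)) !linear_sum /=.
apply: eq_bigr => i _; rewrite !linear_sum /=.
by apply: eq_bigr => j _; rewrite !linearZ /= mulrC.
Qed.

(** On [g], [ad (s X)] is the conjugate of [ad X] by the involution [s], so cyclicity of the trace
    applies. *)
Lemma killing_aut g (s : 'End(M)) : involutive_lie_aut g s ->
    {in g &, forall X Y, lie X Y \in g} ->
  {in g &, forall X Y, killing g (s X) (s Y) = killing g X Y}.
Proof.
move=> [sg slie sK] glie X Y Xg Yg.
have sgP Z : Z \in g -> s Z \in g.
  by move=> Zg; apply: (subvP sg); apply: memv_img.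
rewrite !killingE.
rewrite (@eq_trace_on _ _ (s \o ((lie X \o lie Y) \o s))); last first.
  move=> Z Zg /=; have sZg := sgP _ Zg.
  by rewrite !slie ?sK ?glie // ?sgP.
rewrite trace_onC; last by move=> Z Zg /=; rewrite !glie // sgP.
  by apply: eq_trace_on => Z Zg /=; rewrite sK.
by move=> Z Zg; apply: sgP.
Qed.

End TraceOnSubspace.

(** * Invariance of the trace form under the commutator *)

Section TraceForm.
Variables (R : realType) (n : nat).
Implicit Types (X Y Z : 'M[R]_n).

Lemma mxtrace_lieA X Y Z : \tr (lie X Y *m Z) = \tr (X *m lie Y Z).
Proof.
rewrite /lie mulmxBl mulmxBr !linearB /= !mulmxA; congr (_ - _).
by rewrite -[RHS]mxtrace_mulC !mulmxA.
Qed.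

Lemma lieC X Y : lie X Y = - lie Y X.
Proof. by rewrite /lie opprB. Qed.

Lemma lieNl X Y : lie (- X) Y = - lie X Y.
Proof. by rewrite lieC linearN /= lieC !opprK. Qed.

(** [ad X] is skew for the trace form, so only opposite eigenvalues can pair nontrivially. *)
Lemma mxtrace_lie_eigen X Y Z (c d : R) :
  lie X Y = c *: Y -> lie X Z = d *: Z -> c + d != 0 -> \tr (Y *m Z) = 0.
Proof.
move=> XY XZ cd; apply: (mulfI cd); rewrite mulr0 mulrDl.
rewrite -!mxtraceZ scalemxAl -XY scalemxAr -XZ -mxtrace_lieA -mxtraceD.
by rewrite -mulmxDl lieC addNr mul0mx mxtrace0.
Qed.

End TraceForm.

(** * The Killing form of so(2,l-1) *)

Section SO.
Variables (R : realType) (l : nat).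
Local Notation M := 'M[R]_l.+1.
Local Notation V := 'cV[R]_l.+1.
Local Notation gr := (gram R l).
Local Notation g := (lieG R l).
Implicit Types (X Y Z u : M) (x y z v w : V).

Lemma tr_gram : gr^T = gr.
Proof. exact: tr_diag_mx. Qed.

Lemma gramK : gr *m gr = 1%:M.
Proof.
apply/matrixP => i j; rewrite mul_diag_mx !mxE.
by case: eqP => [->|_]; case: ifP; rewrite ?(mulr1n, mulr0n, mulr0, mulr1, mulrNN).
Qed.

Lemma lieGE X : X \in g -> X^T = - (gr *m X *m gr).
Proof.
rewrite lieGP addr_eq0 => /eqP e.
by rewrite -[LHS]mulmx1 -gramK mulmxA e mulNmx.
Qed.

Lemma memlieG X : X^T = - (gr *m X *m gr) -> X \in g.
Proof. by rewrite lieGP => ->; rewrite mulNmx -!mulmxA gramK mulmx1 addNr. Qed.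

Lemma lie_lieG : {in g &, forall X Y, lie X Y \in g}.
Proof.
move=> X Y /lieGE Xg /lieGE Yg; apply: memlieG.
rewrite /lie linearB /= !trmx_mul Xg Yg !mulNmx !mulmxN !opprK.
rewrite mulmxBr mulmxBl opprB.
have e A B : gr *m A *m gr *m (gr *m B *m gr) = gr *m (A *m B) *m gr.
  by rewrite -!mulmxA (mulmxA gr gr) gramK mul1mx.
by rewrite !e.
Qed.

Lemma mxtrace_lieG X : X \in g -> \tr X = 0.
Proof.
move=> /lieGE Xg; have := mxtrace_tr X.
rewrite Xg linearN /= mxtrace_mulC mulmxA gramK mul1mx => e; lra.
Qed.

(** As [gram] is its own inverse, [gr *m X^T *m gr] is the adjoint of [X] for the form; this is the
    projection onto [g] along the self-adjoint matrices. *)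
Definition skew_proj X : M := 2^-1 *: (X - gr *m X^T *m gr).

Fact skew_proj_linear : linear skew_proj.
Proof.
move=> c X Y; rewrite /skew_proj !linearP /= mulmxDl -scalemxAl.
by rewrite opprD addrACA -scalerBr scalerDr !scalerA mulrC.
Qed.
HB.instance Definition _ :=
  GRing.isLinear.Build R M M _ skew_proj skew_proj_linear.

Lemma skew_proj_lieG X : skew_proj X \in g.
Proof.
apply: memlieG; rewrite /skew_proj linearZ linearB /= !trmx_mul trmxK tr_gram.
rewrite -scalemxAr -scalemxAl -scalerN mulmxBr mulmxBl opprB.
congr (_ *: (_ - _)).
  by rewrite !mulmxA gramK mul1mx -mulmxA gramK mulmx1.
by rewrite mulmxA.
Qed.

Lemma skew_projK X : X \in g -> skew_proj X = X.
Proof.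
move=> /lieGE Xg; rewrite /skew_proj Xg mulmxN mulNmx opprK.
rewrite !mulmxA gramK mul1mx -mulmxA gramK mulmx1 -mulr2n -(scaler_nat 2 X) scalerA.
by rewrite mulVf ?scale1r // pnatr_eq0.
Qed.

(** This computes the trace of [Z |-> X Z Y] on the space of all matrices; the next lemma does the
    same for [Z |-> X Z^T Y]. *)
Lemma sum_mulmx_delta X Y :
  \sum_i \sum_j (X *m delta_mx i j *m Y) i j = \tr X * \tr Y.
Proof.
rewrite /mxtrace mulr_suml; apply: eq_bigr => i _; rewrite mulr_sumr.
apply: eq_bigr => j _; rewrite -mulmxA mxE (bigD1 i) //= big1 => [|k ki].
  rewrite addr0 mxE (bigD1 j) //= big1 => [|k kj].
    by rewrite addr0 mxE !eqxx mul1r.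
  by rewrite mxE (negbTE kj) andbF mul0r.
by rewrite mxE big1 ?mulr0 // => m _; rewrite mxE (negbTE ki) mul0r.
Qed.

Lemma sum_mulmx_delta_tr X Y :
  \sum_i \sum_j (X *m (delta_mx i j)^T *m Y) i j = \tr (X *m Y^T).
Proof.
rewrite /mxtrace; apply: eq_bigr => i _; rewrite mxE.
apply: eq_bigr => j _; rewrite trmx_delta -mulmxA mxE (bigD1 j) //= big1 => [|k kj].
  rewrite addr0 mxE (bigD1 i) //= big1 => [|k ki].
    by rewrite addr0 !mxE !eqxx mul1r.
  by rewrite mxE (negbTE ki) andbF mul0r.
by rewrite mxE big1 ?mulr0 // => m _; rewrite mxE (negbTE kj) mul0r.
Qed.

Lemma sum_mulmx_skew_proj X Y :
  \sum_i \sum_j (X *m skew_proj (delta_mx i j) *m Y) i j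
    = 2^-1 * (\tr X * \tr Y - \tr (X *m gr *m Y^T *m gr)).
Proof.
transitivity (2^-1 * (\sum_i \sum_j (X *m delta_mx i j *m Y) i j
   - \sum_i \sum_j ((X *m gr) *m (delta_mx i j)^T *m (gr *m Y)) i j)).
  rewrite -sumrB mulr_sumr; apply: eq_bigr => i _.
  rewrite -sumrB mulr_sumr; apply: eq_bigr => j _.
  rewrite /skew_proj -scalemxAr -scalemxAl [LHS]mxE; congr (_ * _).
  by rewrite mulmxBr mulmxBl [LHS]mxE [X in _ + X]mxE !mulmxA.
by rewrite sum_mulmx_delta sum_mulmx_delta_tr trmx_mul tr_gram !mulmxA.
Qed.

(** [ad X (ad Y Z)] splits into four products, whose traces are taken after [skew_proj]. With N = l
    + 1, the products [XYZ] and [ZYX] give (N - 1)/2 each and the two mixed ones -1/2 each, times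
    tr(XY). *)
Lemma killing_lieG : {in g &, forall X Y,
  killing g X Y = (l.+1%:R - 2) * \tr (X *m Y)}.
Proof.
move=> X Y Xg Yg; rewrite killingE (@trace_on_mxtrace _ _ _ skew_proj).
- transitivity (\sum_i \sum_j ((X *m Y) *m skew_proj (delta_mx i j) *m 1%:M) i j
   - \sum_i \sum_j (X *m skew_proj (delta_mx i j) *m Y) i j
   - \sum_i \sum_j (Y *m skew_proj (delta_mx i j) *m X) i j
   + \sum_i \sum_j (1%:M *m skew_proj (delta_mx i j) *m (Y *m X)) i j).
    rewrite -!sumrB -big_split; apply: eq_bigr => i _ /=.
    rewrite -!sumrB -big_split; apply: eq_bigr => j _ /=.
    have mxB A B : (A - B : M) i j = A i j - B i j by rewrite mxE [X in _ + X]mxE.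
    by rewrite mulmx1 mul1mx /lie mulmxBr mulmxBl !mxB !mulmxA opprD opprK addrA.
  rewrite !sum_mulmx_skew_proj trmx1 trmx_mul mulmx1 mul1mx.
  rewrite (lieGE Xg) (lieGE Yg) !mxtrace1 !(mxtrace_lieG Xg) !(mxtrace_lieG Yg).
  rewrite !(mulmxN, mulNmx) opprK.
  have e A B : A *m gr *m (gr *m B *m gr) *m gr = A *m B.
    by rewrite -!mulmxA gramK mulmx1 (mulmxA gr gr) gramK mul1mx.
  have e2 : \tr (gr *m (gr *m X *m gr *m (gr *m Y *m gr)) *m gr) = \tr (X *m Y).
    congr mxtrace; rewrite !mulmxA gramK mul1mx.
    by rewrite -!mulmxA gramK mulmx1 (mulmxA gr gr) gramK mul1mx.
  rewrite !e -!(mulmxA _ gr gr) !gramK !mulmx1 !linearN /= e2 (mxtrace_mulC Y X).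
  by field.
- exact: skew_proj_lieG.
- exact: skew_projK.
- by move=> Z Zg /=; rewrite !lie_lieG.
Qed.

End SO.

(** * Membership in eigenspaces and root spaces *)

Lemma eigsubP (R : realType) (n : nat) (g : {vspace 'M[R]_n})
    (s : 'End('M[R]_n)) (c : R) (X : 'M[R]_n) :
  reflect (X \in g /\ s X = c *: X) (X \in eigsub g s c).
Proof.
rewrite /eigsub memv_cap memv_ker !lfun_simp /= subr_eq0.
by apply: (iffP andP) => -[Xg /eqP e]; split => //; apply/eqP.
Qed.

Lemma rootspaceP (R : realType) (n : nat) (g : {vspace 'M[R]_n})
    (J1 J2 X : 'M[R]_n) (c d : R) :
  reflect [/\ X \in g, lie J1 X = c *: X & lie J2 X = d *: X]
    (X \in rootspace g J1 J2 c d).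
Proof.
rewrite /rootspace memv_cap; apply: (iffP andP).
  by case=> /eigsubP[Xg]; rewrite lfunE /= => e1 /eigsubP[_]; rewrite lfunE.
by case=> Xg e1 e2; split; apply/eigsubP; rewrite lfunE.
Qed.

(** * Bilinearity of the trace form *)

Section TraceFormBilinear.
Variables (R : realType) (n : nat).
Implicit Types (X Y Z : 'M[R]_n).

Definition trform X Y : R := \tr (X *m Y).

Lemma trformC X Y : trform X Y = trform Y X.
Proof. exact: mxtrace_mulC. Qed.

Lemma trformDl X Y Z : trform (X + Y) Z = trform X Z + trform Y Z.
Proof. by rewrite /trform mulmxDl linearD. Qed.

Lemma trformNl X Y : trform (- X) Y = - trform X Y.
Proof. by rewrite /trform mulNmx linearN. Qed.

Lemma trformZl c X Y : trform (c *: X) Y = c * trform X Y.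
Proof. by rewrite /trform -scalemxAl linearZ. Qed.

Lemma trformDr X Y Z : trform Z (X + Y) = trform Z X + trform Z Y.
Proof. by rewrite !(trformC Z) trformDl. Qed.

Lemma trformNr X Y : trform Y (- X) = - trform Y X.
Proof. by rewrite !(trformC Y) trformNl. Qed.

Lemma trformZr c X Y : trform Y (c *: X) = c * trform Y X.
Proof. by rewrite !(trformC Y) trformZl. Qed.

Definition trform_lin :=
  (trformDl, trformDr, trformNl, trformNr, trformZl, trformZr).

End TraceFormBilinear.

(** * The form of signature (2,l-1) and its rank-two skew operators *)

Section InnerProduct.
Variables (R : realType) (l : nat).
Local Notation M := 'M[R]_l.+1.
Local Notation V := 'cV[R]_l.+1.
Local Notation gr := (gram R l).
Local Notation g := (lieG R l).
Implicit Types (X Y Z u : M) (x y z v w : V).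

Definition ip x y : R := (x^T *m gr *m y) 0 0.

Lemma ip_sqnorm x : ip x x = sqnorm x. Proof. by []. Qed.

Lemma ip_mx x y : x^T *m gr *m y = (ip x y)%:M.
Proof. exact: mx11_scalar. Qed.

Lemma ipE x y :
  ip x y = \sum_(i < l.+1) (if (i < 2)%N then 1 else -1) * (x i 0 * y i 0).
Proof.
rewrite /ip mul_mx_diag mxE; apply: eq_bigr => i _.
by rewrite !mxE mulrAC mulrC.
Qed.

Lemma ipC x y : ip x y = ip y x.
Proof. by rewrite !ipE; apply: eq_bigr => i _; rewrite (mulrC (x i 0)). Qed.

Lemma ipDl x y z : ip (x + y) z = ip x z + ip y z.
Proof. by rewrite /ip linearD /= !mulmxDl mxE. Qed.

Lemma ipZl c x y : ip (c *: x) y = c * ip x y.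
Proof. by rewrite /ip linearZ /= -!scalemxAl mxE. Qed.

Lemma ipNl x y : ip (- x) y = - ip x y.
Proof. by rewrite -scaleN1r ipZl mulN1r. Qed.

Lemma ip0l x : ip 0 x = 0.
Proof. by rewrite -(scale0r 0) ipZl mul0r. Qed.

Lemma ipDr x y z : ip z (x + y) = ip z x + ip z y.
Proof. by rewrite !(ipC z) ipDl. Qed.

Lemma ipZr c x y : ip y (c *: x) = c * ip y x.
Proof. by rewrite !(ipC y) ipZl. Qed.

Lemma ipNr x y : ip y (- x) = - ip y x.
Proof. by rewrite !(ipC y) ipNl. Qed.

Lemma ip_suml (I : Type) (r : seq I) (F : I -> V) y :
  ip (\sum_(i <- r) F i) y = \sum_(i <- r) ip (F i) y.
Proof.
elim/big_rec2: _ => [|i a b _ <-]; first exact: ip0l.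
by rewrite ipDl.
Qed.

Lemma ip_lieG X x y : X \in g -> ip (X *m x) y = - ip x (X *m y).
Proof.
rewrite lieGP addr_eq0 => /eqP e.
by rewrite /ip trmx_mul -(mulmxA _ X^T) e mulmxN mulNmx mxE !mulmxA.
Qed.

Lemma ip_lieG_self X x : X \in g -> ip x (X *m x) = 0.
Proof. by move=> Xg; have := ip_lieG x x Xg; rewrite ipC; lra. Qed.

(* Signature (2, l-1): of three vectors, some combination has vanishing first
   two coordinates. *)
Lemma sqnorm_orthogonal_triple x y z : 0 < ip x x -> 0 < ip y y ->
  ip x y = 0 -> ip x z = 0 -> ip y z = 0 -> ip z z <= 0.
Proof.
move=> x0 y0 xy xz yz; rewrite leNgt; apply/negP => z0.
pose t (i : 'I_3) : V := nth 0 [:: x; y; z] i.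
pose A : 'M[R]_(3, 2) := \matrix_(i, j) t i (inord j) 0.
have : kermx A != 0.
  rewrite -mxrank_eq0 mxrank_ker subn_eq0 -ltnNge.
  exact: leq_ltn_trans (rank_leq_col A) _.
case/rowV0Pn => c /sub_kermxP cA c0.
pose s : V := \sum_i c 0 i *: t i.
have s0 (i : 'I_l.+1) : (i < 2)%N -> s i 0 = 0.
  move=> i2; have /(congr1 (fun B : 'rV[R]_2 => B 0 (Ordinal i2))) := cA.
  rewrite mxE [RHS]mxE => e; rewrite -[RHS]e /s summxE.
  by apply: eq_bigr => k _; rewrite !mxE /= inord_val.
have : ip s s <= 0.
  rewrite ipE; apply: sumr_le0 => i _; case: ifP => i2.
    by rewrite s0 // !mulr0.
  by rewrite mulN1r oppr_le0 -expr2 sqr_ge0.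
(* Orthogonality makes the norm of [s] a sum of squares with positive weights; being nonpositive, it
   forces all coefficients to vanish. *)
have -> : ip s s = c 0 0 ^+ 2 * ip x x + c 0 1 ^+ 2 * ip y y
                   + c 0 (inord 2) ^+ 2 * ip z z.
  have -> : s = c 0 0 *: x + c 0 1 *: y + c 0 (inord 2) *: z.
    rewrite /s !big_ord_recl big_ord0 addr0 addrA /t /=.
    congr (_ + c 0 _ *: y + c 0 _ *: _).
      exact: val_inj.
    by apply: val_inj; rewrite /= inordK.
  rewrite !(ipDl, ipDr, ipZl, ipZr) (ipC y x) (ipC z x) (ipC z y) xy xz yz.
  by ring.
move=> le0; case/eqP: c0; apply/rowP => i; rewrite mxE.
have sq (a b : R) : 0 < b -> 0 <= a ^+ 2 * b.
  by move=> b0; rewrite mulr_ge0 ?sqr_ge0 // ltW.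
have z_of (a b : R) : 0 < b -> a ^+ 2 * b <= 0 -> a = 0.
  move=> b0; rewrite pmulr_lle0 // => h; apply/eqP.
  by rewrite -sqrf_eq0 eq_le h sqr_ge0.
have hx := sq (c 0 0) _ x0; have hy := sq (c 0 1) _ y0.
have hz := sq (c 0 (inord 2)) _ z0.
have := ltn_ord i; case: i => -[|[|[|//]]] hi _.
- by rewrite (_ : Ordinal hi = 0); [apply: z_of x0 _; lra | exact: val_inj].
- by rewrite (_ : Ordinal hi = 1); [apply: z_of y0 _; lra | exact: val_inj].
- rewrite (_ : Ordinal hi = inord 2); first by apply: z_of z0 _; lra.
  by apply: val_inj; rewrite /= inordK.
Qed.

(** The image of a bivector under the usual identification of the exterior square with [g]; the row
    [v^T *m gr] is the linear form <v,.>. *)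
Definition wedge w v : M := w *m (v^T *m gr) - v *m (w^T *m gr).

Lemma wedgeE w v x : wedge w v *m x = ip v x *: w - ip w x *: v.
Proof. by rewrite /wedge mulmxBl -(mulmxA w) -(mulmxA v) !ip_mx !mul_mx_scalar. Qed.

Lemma wedge_lieG w v : wedge w v \in g.
Proof.
apply: memlieG; rewrite /wedge linearB /= !trmx_mul !trmxK !tr_gram.
rewrite mulmxBr mulmxBl opprB; congr (_ - _);
  by rewrite !mulmxA -[RHS]mulmxA gramK mulmx1.
Qed.

(** Each rank-one term contributes a pairing as its trace, and skewness of [Y] makes the two
    contributions equal. *)
Lemma trform_wedge w v Y : Y \in g ->
  trform (wedge w v) Y = - 2 * ip w (Y *m v).
Proof.
move=> Yg; rewrite /trform /wedge mulmxBl linearB /= -(mulmxA w) -(mulmxA v).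
rewrite (mxtrace_mulC w) (mxtrace_mulC v) -!(mulmxA _ Y) !ip_mx.
rewrite !mxtrace_scalar !mulr1n.
by rewrite ipC ip_lieG //; ring.
Qed.

(** Evaluating the eigenvalue equation at [v] and [w] gives linear relations between [X v] and
    [X w]. Unless <w,w> = -1 they force both to vanish; then the skew [X] commutes with [wedge w v],
    and the equation makes it 0. *)
Lemma wedge_eigen w v X : ip v v = 1 -> ip v w = 0 -> X \in g -> X != 0 ->
  lie (wedge w v) X = X -> ip w w = -1.
Proof.
move=> v1 vw Xg Xn0 e; pose x := X *m v; pose y := X *m w.
have ex : - ip w x *: v - y = x.
  rewrite [RHS](erefl : x = X *m v) -[in RHS]e /lie mulmxBl -!mulmxA !wedgeE v1.
  by rewrite (ip_lieG_self _ Xg) (ipC w v) vw !scale0r sub0r subr0 scale1r scaleNr.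
have ey : - ip w x *: w + ip w w *: x = y.
  rewrite [RHS](erefl : y = X *m w) -[in RHS]e /lie mulmxBl -!mulmxA !wedgeE vw.
  rewrite (ip_lieG_self _ Xg) !scale0r subr0 sub0r mulmxN opprK linearZ /=.
  by rewrite (_ : ip v _ = - ip w x) // ipC ip_lieG.
have vx : ip v x = 0 by exact: ip_lieG_self.
have e2 : (1 + ip w w) *: x = ip w x *: (w - v).
  rewrite scalerDl scale1r -[X in X + _ = _]ex -ey scalerBr !scaleNr.
  by rewrite opprD opprK addrA subrK addrC.
(* Pairing with [v] kills the left side, since [x] is orthogonal to [v], and leaves -<w,x> on the
   right. *)
have t0 : ip w x = 0.
  have := congr1 (ip v) e2; rewrite !ipZr ipDr ipNr v1 vw vx; lra.
apply/eqP; rewrite -subr_eq0 opprK addrC; apply: contraNT Xn0 => w1.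
have x0 : x = 0.
  by apply: (scalerI w1); rewrite e2 t0 scale0r scaler0.
have y0 : y = 0 by rewrite -ey t0 x0 oppr0 scale0r scaler0 addr0.
have trX z : X *m z = 0 -> z^T *m gr *m X = 0.
  move=> Xz; move: Xg; rewrite lieGP addrC addr_eq0 => /eqP Xg.
  by rewrite -mulmxA Xg mulmxN mulmxA -trmx_mul Xz trmx0 mul0mx oppr0.
rewrite -e /lie /wedge mulmxBl mulmxBr -(mulmxA w) -(mulmxA v) !trX //.
by rewrite (mulmxA X w) (mulmxA X v) -/x -/y x0 y0 !mulmx0 !mul0mx !subr0.
Qed.

End InnerProduct.

(** * The symmetric pair and the description of [q] by the values [X v] *)

Section SymmetricPair.
Variables (R : realType) (l : nat).
Hypothesis l_ge3 : (3 <= l)%N.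
Local Notation M := 'M[R]_l.+1.
Local Notation g := (lieG R l).
Variables (v : 'cV[R]_l.+1) (sigma theta : 'End(M)).
Hypothesis v_norm : sqnorm v = 1.
Hypothesis sigma_inv : involutive_lie_aut g sigma.
Hypothesis sigma_fix : eigsub g sigma 1 = lieH v.
Hypothesis theta_cartan : cartan_involution g theta.
Hypothesis sigma_theta :
  {in g, forall X, sigma (theta X) = theta (sigma X)}.
Local Notation q := (eigsub g sigma (-1)).
Implicit Types (X Y Z : M).

Lemma killing_coef_gt0 : 0 < l.+1%:R - 2 :> R.
Proof. by rewrite subr_gt0 ltr_nat; exact: leq_trans l_ge3 _. Qed.

Lemma qnormE X : X \in g -> qnorm X = - 2^-1 * trform X X.
Proof.
move=> Xg; rewrite /qnorm killing_lieG // -/(trform X X) natrB; last first.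
  exact: leq_trans l_ge3.
rewrite -(natr1 l); have := killing_coef_gt0; rewrite -natr1 => h.
have l0 : l%:R - 1 != 0 :> R by apply: lt0r_neq0; lra.
by field.
Qed.

(** An automorphism of [g] is not assumed to be a conjugation, so invariance comes from the Killing
    form, a nonzero multiple of the trace form. *)
Lemma trform_aut (s : 'End(M)) : involutive_lie_aut g s ->
  {in g &, forall X Y, trform (s X) (s Y) = trform X Y}.
Proof.
move=> saut X Y Xg Yg; have := killing_aut saut (@lie_lieG _ _) Xg Yg.
have sgP Z : Z \in g -> s Z \in g.
  by case: saut => sg _ _ Zg; apply: (subvP sg); apply: memv_img.
by rewrite !killing_lieG ?sgP //; apply: mulfI; apply: lt0r_neq0 killing_coef_gt0.
Qed.

Lemma sigma_lieG X : X \in g -> sigma X \in g.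
Proof.
by case: sigma_inv => sg _ _ Xg; apply: (subvP sg); apply: memv_img.
Qed.

Lemma theta_lieG X : X \in g -> theta X \in g.
Proof.
by case: theta_cartan => -[tg _ _] _ Xg; apply: (subvP tg); apply: memv_img.
Qed.

Lemma sigmaK : {in g, forall X, sigma (sigma X) = X}.
Proof. by case: sigma_inv. Qed.

Lemma thetaK : {in g, forall X, theta (theta X) = X}.
Proof. by case: theta_cartan => -[]. Qed.

Lemma sigma_lie : {in g &,
  forall X Y, sigma (lie X Y) = lie (sigma X) (sigma Y)}.
Proof. by case: sigma_inv. Qed.

Lemma theta_lie : {in g &,
  forall X Y, theta (lie X Y) = lie (theta X) (theta Y)}.
Proof. by case: theta_cartan => -[]. Qed.

Lemma trform_theta_lt0 X : X \in g -> X != 0 -> trform X (theta X) < 0.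
Proof.
move=> Xg X0; case: theta_cartan => _ /(_ X Xg X0).
rewrite killing_lieG ?theta_lieG // -mulrN pmulr_rgt0 ?killing_coef_gt0 //.
by rewrite oppr_gt0.
Qed.

Lemma lieHE X : reflect (X \in g /\ sigma X = X) (X \in lieH v).
Proof.
by rewrite -sigma_fix; apply: (iffP (eigsubP _ _ _ _)); rewrite scale1r.
Qed.

Lemma qE X : reflect (X \in g /\ sigma X = - X) (X \in q).
Proof. by apply: (iffP (eigsubP _ _ _ _)); rewrite scaleN1r. Qed.

Lemma trform_q_lieH X Y : X \in q -> Y \in lieH v -> trform X Y = 0.
Proof.
move=> /qE[Xg sX] /lieHE[Yg sY]; have := trform_aut sigma_inv Xg Yg.
by rewrite sX sY trformNl; lra.
Qed.

(* The difference of the two sides lies in h and is orthogonal to h, on which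
   the trace form is nondegenerate because theta preserves h. *)
Lemma q_wedge X : X \in q -> X = wedge (X *m v) v.
Proof.
move=> Xq; have [Xg _] := qE _ Xq; apply/eqP; rewrite -subr_eq0.
set D := X - _; have Dg : D \in g by rewrite rpredB // wedge_lieG.
have Dh : D \in lieH v.
  rewrite lieHP Dg mulmxBl wedgeE ip_sqnorm v_norm scale1r ipC.
  by rewrite (ip_lieG_self _ Xg) scale0r subr0 subrr eqxx.
have Dperp Y : Y \in lieH v -> trform D Y = 0.
  move=> Yh; rewrite trformDl trformNl trform_q_lieH //.
  move: Yh; rewrite lieHP => /andP[Yg /eqP Yv].
  by rewrite trform_wedge // Yv ipC ip0l mulr0 subr0.
apply: contraT => /(trform_theta_lt0 Dg); rewrite Dperp ?ltxx //.
by apply/lieHE; rewrite theta_lieG // sigma_theta //; case/lieHE: Dh => _ ->.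
Qed.

Lemma trform_q X Y : X \in q -> Y \in g ->
  trform X Y = - 2 * ip (X *m v) (Y *m v).
Proof. by move=> /q_wedge {1}-> Yg; rewrite trform_wedge. Qed.

Lemma qnorm_q X : X \in q -> qnorm X = ip (X *m v) (X *m v).
Proof.
move=> Xq; have [Xg _] := qE _ Xq; rewrite qnormE // trform_q //.
by field.
Qed.

(** [J] is the wedge of [J v] and [v], so [wedge_eigen] gives <Jv,Jv> = -1; the factor -2 of
    [trform_q] then yields 2. *)
Lemma q_lie_eigen J X : J \in q -> X \in g -> X != 0 -> lie J X = X ->
  trform J J = 2.
Proof.
move=> Jq Xg X0; have [Jg _] := qE _ Jq.
rewrite trform_q // {1}(q_wedge Jq) => /wedge_eigen -> //.
- by rewrite mulrNN mulr1.
- exact: ip_lieG_self.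
Qed.

(** * The long root vector and the elements [q0] and [q2] *)

Variables J1 J2 Xpp : M.
Hypothesis J1_h : J1 \in lieH v.
Hypothesis J2_q : J2 \in q.
Hypothesis theta_J1 : theta J1 = - J1.
Hypothesis theta_J2 : theta J2 = - J2.
Hypothesis lie_J2_J1 : lie J2 J1 = 0.
Hypothesis Xpp_g : Xpp \in g.
Hypothesis J1_Xpp : lie J1 Xpp = Xpp.
Hypothesis J2_Xpp : lie J2 Xpp = Xpp.
Hypothesis Xpp_norm : lie (theta Xpp) Xpp = 4 *: (J1 + J2).
Hypothesis Xpp_neq0 : Xpp != 0.
Local Notation q0 := (q0vec sigma theta Xpp).
Local Notation q2 := (- lie J1 q0).

Lemma J1_g : J1 \in g. Proof. by have [] := lieHE _ J1_h. Qed.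
Lemma J2_g : J2 \in g. Proof. by have [] := qE _ J2_q. Qed.

Lemma trform_J2_J2 : trform J2 J2 = 2.
Proof. exact: q_lie_eigen J2_Xpp. Qed.

Lemma trform_J2_J1 : trform J2 J1 = 0.
Proof. exact: trform_q_lieH. Qed.

(** Together with the two lemmas that follow: [theta] sends the weight (c,d) to (-c,-d), and [sigma]
    sends it to (c,-d). *)
Lemma theta_eigen J X c : J \in g -> theta J = - J -> X \in g ->
  lie J X = c *: X -> lie J (theta X) = - c *: theta X.
Proof.
move=> Jg tJ Xg e; have := theta_lie Jg Xg.
by rewrite e tJ lieNl linearZ /= scaleNr => ->; rewrite opprK.
Qed.

Lemma sigma_eigen1 X c : X \in g ->
  lie J1 X = c *: X -> lie J1 (sigma X) = c *: sigma X.
Proof.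
move=> Xg e; have [J1g sJ1] := lieHE _ J1_h.
by have := sigma_lie J1g Xg; rewrite e sJ1 linearZ.
Qed.

Lemma sigma_eigen2 X c : X \in g ->
  lie J2 X = c *: X -> lie J2 (sigma X) = - c *: sigma X.
Proof.
move=> Xg e; have [J2g sJ2] := qE _ J2_q.
by have := sigma_lie J2g Xg; rewrite e sJ2 lieNl linearZ /= scaleNr => ->; rewrite opprK.
Qed.

Lemma trform_lieA X Y Z : trform (lie X Y) Z = trform X (lie Y Z).
Proof. exact: mxtrace_lieA. Qed.

Lemma trform_eigen J X Y c d :
  lie J X = c *: X -> lie J Y = d *: Y -> c + d != 0 -> trform X Y = 0.
Proof. exact: mxtrace_lie_eigen. Qed.

(** The normalization of [Xpp] is paired with [J2]: one side is 4 tr(J2 J2) = 8, the other is, by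
    invariance, minus the trace sought. *)
Lemma trform_Xpp_theta : trform Xpp (theta Xpp) = - 8.
Proof.
have tX : lie J2 (theta Xpp) = - 1 *: theta Xpp.
  by apply: theta_eigen; rewrite ?J2_g // scale1r.
have := trform_lieA J2 (theta Xpp) Xpp.
rewrite Xpp_norm tX trformZl trformZr trformDr trform_J2_J1 trform_J2_J2.
by rewrite (trformC (theta _)); lra.
Qed.

(** The four vectors have weights (1,1), (1,-1), (-1,-1), (-1,1). Only opposite weights pair
    nontrivially, which leaves [Xpp] with [theta Xpp] and the [sigma]-images of these two; both
    pairings equal -8. *)
Lemma trform_q0vec (s1 s2 s3 t1 t2 t3 : R) :
  trform (Xpp + s1 *: sigma Xpp + s2 *: theta Xpp + s3 *: sigma (theta Xpp))
    (Xpp + t1 *: sigma Xpp + t2 *: theta Xpp + t3 *: sigma (theta Xpp))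
  = - 8 * (s2 + t2 + s1 * t3 + s3 * t1).
Proof.
have tg := theta_lieG Xpp_g.
have e1 : lie J1 Xpp = 1 *: Xpp by rewrite scale1r.
have e2 : lie J2 Xpp = 1 *: Xpp by rewrite scale1r.
have te1 := theta_eigen J1_g theta_J1 Xpp_g e1.
have te2 := theta_eigen J2_g theta_J2 Xpp_g e2.
have se1 := sigma_eigen1 Xpp_g e1; have se2 := sigma_eigen2 Xpp_g e2.
have ste1 := sigma_eigen1 tg te1; have ste2 := sigma_eigen2 tg te2.
have n1 : (1 + 1 : R) != 0 by rewrite lt0r_neq0 //; lra.
have n2 : (- 1 + - 1 : R) != 0 by rewrite ltr0_neq0 //; lra.
have n3 : (1 + - - 1 : R) != 0 by rewrite opprK.
have n4 : (- - 1 + - - 1 : R) != 0 by rewrite opprK.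
rewrite !trform_lin (trformC (sigma Xpp) Xpp) (trformC (theta Xpp) Xpp).
rewrite !(trformC (sigma (theta Xpp)) _) (trformC (theta Xpp) (sigma _)).
rewrite (trform_eigen e1 e1 n1) (trform_eigen e1 se1 n1).
rewrite (trform_eigen e2 ste2 n3) (trform_eigen se1 se1 n1).
rewrite (trform_eigen se2 te2 n2) (trform_eigen te1 te1 n2).
rewrite (trform_eigen te1 ste1 n2) (trform_eigen ste1 ste1 n2).
rewrite (trform_aut sigma_inv) // trform_Xpp_theta.
by ring.
Qed.

Lemma q0E : q0 = 4^-1 *: (Xpp + (- 1) *: sigma Xpp + 1 *: theta Xpp
                          + (- 1) *: sigma (theta Xpp)).
Proof. by rewrite /q0vec !scaleN1r scale1r. Qed.

(** [ad J1] acts on the four summands of [q0] by 1, 1, -1, -1. *)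
Lemma q2E : q2 = 4^-1 *: ((- 1) *: (Xpp + (- 1) *: sigma Xpp
                   + (- 1) *: theta Xpp + 1 *: sigma (theta Xpp))).
Proof.
have tg := theta_lieG Xpp_g.
have e1 : lie J1 Xpp = 1 *: Xpp by rewrite scale1r.
have te1 := theta_eigen J1_g theta_J1 Xpp_g e1.
have se1 := sigma_eigen1 Xpp_g e1; have ste1 := sigma_eigen1 tg te1.
rewrite /q0vec linearZ linearB linearD linearB /= J1_Xpp te1 se1 ste1.
by rewrite scaleN1r -scalerN !scale1r !scaleN1r opprK.
Qed.

Lemma trform_q0 : trform q0 q0 = - 2.
Proof. by rewrite q0E trformZl trformZr trform_q0vec; field. Qed.

Lemma trform_q2 : trform q2 q2 = 2.
Proof. by rewrite q2E !(trformZl, trformZr) trform_q0vec; field. Qed.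

Lemma q0_q : q0 \in q.
Proof.
apply/qE; have tg := theta_lieG Xpp_g; have sg := sigma_lieG Xpp_g.
have stg := sigma_lieG tg; split.
  by rewrite /q0vec rpredZ // rpredB // rpredD // rpredB.
rewrite /q0vec linearZ linearB linearD linearB /= !sigmaK // -scalerN.
by congr (_ *: _); rewrite !(opprD, opprK) (addrC (- Xpp)) -addrA
  (addrC _ (- theta Xpp)) addrA.
Qed.

Lemma theta_q0 : theta q0 = q0.
Proof.
have tg := theta_lieG Xpp_g; have sg := sigma_lieG Xpp_g.
rewrite /q0vec linearZ linearB linearD linearB /= sigma_theta //.
by rewrite !thetaK //; congr (_ *: _); rewrite -[LHS]addrA [LHS]addrC addrA.
Qed.

Lemma q0_g : q0 \in g. Proof. by have [] := qE _ q0_q. Qed.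

Lemma q2_q : q2 \in q.
Proof.
have [g0 s0] := qE _ q0_q; have [gJ sJ] := lieHE _ J1_h.
by apply/qE; rewrite rpredN lie_lieG // linearN /= sigma_lie // s0 sJ linearN.
Qed.

Lemma theta_q2 : theta q2 = - q2.
Proof. by rewrite linearN /= theta_lie ?J1_g ?q0_g // theta_q0 theta_J1 lieNl. Qed.

Lemma lie_J1_J1_q0 : lie J1 (lie J1 q0) = q0.
Proof.
have tg := theta_lieG Xpp_g.
have e1 : lie J1 Xpp = 1 *: Xpp by rewrite scale1r.
have te1 := theta_eigen J1_g theta_J1 Xpp_g e1.
have se1 := sigma_eigen1 Xpp_g e1; have ste1 := sigma_eigen1 tg te1.
rewrite /q0vec linearZ linearB linearD linearB /= J1_Xpp te1 se1 ste1.
rewrite linearZ linearB linearD linearB !linearZ /= J1_Xpp te1 se1 ste1.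
by rewrite !scaleN1r !scale1r !opprK.
Qed.

Lemma trform_kp X Y : X \in g -> Y \in g -> theta X = X -> theta Y = - Y ->
  trform X Y = 0.
Proof.
move=> Xg Yg tX tY; case: theta_cartan => /trform_aut/(_ _ _ Xg Yg) + _.
by rewrite tX tY trformNr; lra.
Qed.

(** [q0] lies in the image of [ad J1], which invariance makes orthogonal to the kernel. *)
Lemma trform_centJ1_q0 Z : lie J1 Z = 0 -> trform Z q0 = 0.
Proof.
move=> e; rewrite -lie_J1_J1_q0 -trform_lieA lieC e oppr0.
by rewrite /trform mul0mx mxtrace0.
Qed.

Lemma trform_centJ1_q2 Z : lie J1 Z = 0 -> trform Z q2 = 0.
Proof.
move=> e; rewrite trformNr -trform_lieA lieC e oppr0.
by rewrite /trform mul0mx mxtrace0 oppr0.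
Qed.

(* Otherwise Z would be, besides q0, a second vector of positive norm in q. *)
Lemma q_k_centJ1 Z : Z \in q -> theta Z = Z -> lie J1 Z = 0 -> Z = 0.
Proof.
move=> Zq tZ cZ; have [Zg _] := qE _ Zq; apply: contraTeq isT => Z0.
have := trform_theta_lt0 Zg Z0; rewrite tZ trform_q // => Zneg.
have := trform_centJ1_q0 cZ; rewrite trform_q ?q0_g // => Z_q0.
have := trform_q0; rewrite trform_q ?q0_g ?q0_q // => q0q0.
have : ip (Z *m v) (Z *m v) <= 0; last by lra.
(* The third positive direction is [v] itself, since elements of [g] send [v] into its orthogonal
   complement. *)
apply: (@sqnorm_orthogonal_triple _ _ v (q0 *m v)).
- by rewrite ip_sqnorm v_norm.
- lra.
- by apply: ip_lieG_self; exact: q0_g.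
- exact: ip_lieG_self.
- by rewrite ipC; lra.
Qed.

(** * Short root vectors *)

Lemma short_root_theta_eigen X : X \in g -> lie J1 X = 0 -> lie J2 X = X ->
  lie J1 (theta X) = 0 /\ lie J2 (theta X) = - theta X.
Proof.
move=> X_g J1_X J2_X; have e1 : lie J1 X = 0 *: X by rewrite scale0r.
have e2 : lie J2 X = 1 *: X by rewrite scale1r.
rewrite (theta_eigen J1_g theta_J1 X_g e1) (theta_eigen J2_g theta_J2 X_g e2).
by rewrite oppr0 scale0r scaleN1r.
Qed.

(** The defect [X' = X - sigma (theta X)] has the same weight as [X] and satisfies
    [sigma X' = - theta X']. Hence [X' + theta X'] lies in [q], is fixed by [theta] and commutes
    with [J1], so it vanishes. *)
Lemma short_root_sigma X : X \in g -> lie J1 X = 0 -> lie J2 X = X ->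
  sigma X = theta X.
Proof.
move=> Xg e1 e2; have tg := theta_lieG Xg; have stg := sigma_lieG tg.
have sg := sigma_lieG Xg.
have [te1 te2] := short_root_theta_eigen Xg e1 e2.
pose X' := X - sigma (theta X).
have X'g : X' \in g by rewrite rpredB.
have X'1 : lie J1 X' = 0.
  have te1' : lie J1 (theta X) = 0 *: theta X by rewrite scale0r.
  by rewrite linearB /= e1 (sigma_eigen1 tg te1') scale0r subrr.
have X'2 : lie J2 X' = X'.
  have te2' : lie J2 (theta X) = - 1 *: theta X by rewrite scaleN1r.
  by rewrite linearB /= e2 (sigma_eigen2 tg te2') opprK scale1r.
have [tX'1 tX'2] := short_root_theta_eigen X'g X'1 X'2.
have tX' : theta X' = theta X - sigma X.
  by rewrite /X' linearB /= -sigma_theta // thetaK.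
have sX' : sigma X' = - theta X'.
  by rewrite tX' opprB /X' linearB /= sigmaK.
have Z0 : X' + theta X' = 0.
  apply: q_k_centJ1.
  - apply/qE; split; first by rewrite rpredD // theta_lieG.
    by rewrite linearD /= sigma_theta // sX' linearN /= thetaK // -opprD addrC.
  - by rewrite linearD /= thetaK // addrC.
  - by rewrite linearD /= X'1 tX'1 addr0.
(* The two summands have opposite [J2]-weights, so [ad J2] turns their sum into their difference;
   both being 0, so is [X']. *)
have : lie J2 (X' + theta X') = 0 by rewrite Z0 linear0.
rewrite linearD /= X'2 tX'2 => /eqP; rewrite subr_eq0 => /eqP Xt.
have X'0 : X' = 0.
  have : 2 *: X' = 0 by rewrite scaler_nat mulr2n {2}Xt.
  by move/eqP; rewrite scaler_eq0 pnatr_eq0 => /eqP.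
by apply/eqP; rewrite eq_sym -subr_eq0 -tX' X'0 linear0 eqxx.
Qed.

Lemma short_root_q X : X \in g -> lie J1 X = 0 -> lie J2 X = X ->
  2^-1 *: (X - theta X) \in q.
Proof.
move=> Xg e1 e2; apply/qE; have tg := theta_lieG Xg; split.
  by rewrite rpredZ // rpredB.
have sX := short_root_sigma Xg e1 e2.
by rewrite linearZ linearB /= -sX sigmaK // -scalerN opprB.
Qed.

Lemma trform_short_root X : X \in g -> lie J2 X = X ->
  lie J1 X = 0 -> lie (theta X) X = 2 *: J2 -> trform X (theta X) = - 4.
Proof.
move=> Xg e2 e1 eX; have [_ te2] := short_root_theta_eigen Xg e1 e2.
have := trform_lieA J2 (theta X) X.
by rewrite eX te2 trformNl trformZr trform_J2_J2 (trformC (theta _)); lra.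
Qed.

(** Equal nonzero [J2]-weights kill the pairings of [X] with [Y] and of their [theta]-images; the
    two cross terms agree because [theta] is an isometric involution. *)
Lemma trform_short_roots X Y : X \in g -> Y \in g ->
    lie J1 X = 0 -> lie J2 X = X -> lie J1 Y = 0 -> lie J2 Y = Y ->
  trform (2^-1 *: (X - theta X)) (2^-1 *: (Y - theta Y))
    = - 2^-1 * trform X (theta Y).
Proof.
move=> Xg Yg X1 X2 Y1 Y2; have [_ tX2] := short_root_theta_eigen Xg X1 X2.
have [_ tY2] := short_root_theta_eigen Yg Y1 Y2.
have taut : involutive_lie_aut g theta by case: theta_cartan.
have XY : trform X Y = 0.
  apply: (@trform_eigen J2 _ _ 1 1); rewrite ?scale1r //.
have tXtY : trform (theta X) (theta Y) = 0 by rewrite trform_aut.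
have tXY : trform (theta X) Y = trform X (theta Y).
  by rewrite -(trform_aut taut) ?theta_lieG // thetaK.
by rewrite !trform_lin XY tXtY tXY; field.
Qed.

(** * The Gram matrix of the whole family q_0, ..., q_{l-1} *)

Variable X0p : nat -> M.
Hypothesis X0pP : forall k, (3 <= k <= l - 1)%N ->
  [/\ X0p k \in g, lie J1 (X0p k) = 0 & lie J2 (X0p k) = X0p k].
Hypothesis X0p_norm : forall k, (3 <= k <= l - 1)%N ->
  lie (theta (X0p k)) (X0p k) = 2 *: J2.
Hypothesis X0p_orth : forall j k, (3 <= j <= l - 1)%N -> (3 <= k <= l - 1)%N ->
  j != k -> killing g (X0p j) (theta (X0p k)) = 0.
Local Notation qv := (qvec sigma theta J1 J2 Xpp X0p).

Lemma qvec_q k : (k < l)%N -> qv k \in q.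
Proof.
case: k => [|[|[|k]]] kl //=; [exact: q0_q | exact: q2_q |].
by have [] := X0pP (k := k.+3); [lia | exact: short_root_q].
Qed.

Lemma theta_qvec k : (0 < k < l)%N -> theta (qv k) = - qv k.
Proof.
case: k => [|[|[|k]]] // kl; first exact: theta_q2.
have [|Xg _ _] := X0pP (k := k.+3); first by lia.
by rewrite /= linearZ linearB /= thetaK // -scalerN opprB.
Qed.

(** [theta] fixes q_0 and negates the others. Among these, q_2 is in the image of [ad J1] while the
    rest commute with [J1]; [J2] has [J2]-weight 0 against 1 and -1 for the parts of q_k, k >= 3;
    the latter are mutually orthogonal by the choice of [X0p]. *)
Lemma trform_qvec i j : (i < l)%N -> (j < l)%N ->
  trform (qv i) (qv j) = if i == j then (if (i < 1)%N then - 2 else 2) else 0.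
Proof.
wlog ij : i j / (i <= j)%N => [ih|il jl].
  case: (leqP i j) => [|/ltnW ji] il jl; first exact: ih.
  by rewrite trformC ih // eq_sym; case: eqP => [->|].
have qg k : (k < l)%N -> qv k \in g by move=> kl; have [] := qE _ (qvec_q kl).
have cent k : (3 <= k < l)%N -> lie J1 (qv k) = 0.
  case: k => [|[|[|k]]] // kl; have [|Xg X1 X2] := X0pP (k := k.+3); first by lia.
  have [tX1 _] := short_root_theta_eigen Xg X1 X2.
  by rewrite /= linearZ linearB /= X1 tX1 subrr scaler0.
case: i ij il => [|[|[|i]]] ij il.
- case: j ij jl => [|j] _ jl; first exact: trform_q0.
  by apply: trform_kp; [exact: (qg 0%N) | exact: (qg j.+1) | exact: theta_q0
    | exact: theta_qvec].
- case: j ij jl => [|[|[|j]]] // _ jl; first exact: trform_J2_J2.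
    by apply: trform_centJ1_q2; rewrite lieC lie_J2_J1 oppr0.
  have [|Xg X1 X2] := X0pP (k := j.+3); first by lia.
  have [_ tX2] := short_root_theta_eigen Xg X1 X2.
  have J22 : lie J2 J2 = 0 *: J2 by rewrite scale0r /lie subrr.
  have X2' : lie J2 (X0p j.+3) = 1 *: X0p j.+3 by rewrite scale1r.
  have tX2' : lie J2 (theta (X0p j.+3)) = - 1 *: theta (X0p j.+3).
    by rewrite scaleN1r.
  rewrite /= !trform_lin (trform_eigen J22 X2') ?add0r ?oner_eq0 //.
  by rewrite (trform_eigen J22 tX2') ?add0r ?oppr_eq0 ?oner_eq0 // oppr0 mulr0.
- case: j ij jl => [|[|[|j]]] // _ jl; first exact: trform_q2.
  by rewrite trformC; apply: trform_centJ1_q2; apply: cent.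
- case: j ij jl => [|[|[|j]]] // ij jl.
  have [|Xg X1 X2] := X0pP (k := i.+3); first by lia.
  have [|Yg Y1 Y2] := X0pP (k := j.+3); first by lia.
  rewrite /= trform_short_roots //; case: eqP => [[<-]|/eqP ne].
    by rewrite trform_short_root ?X0p_norm //; [field | lia].
  have : killing g (X0p i.+3) (theta (X0p j.+3)) = 0.
    by apply: X0p_orth => //; lia.
  rewrite killing_lieG ?theta_lieG // -/(trform _ _) => /eqP.
  by rewrite mulf_eq0 gt_eqF ?killing_coef_gt0 //= => /eqP ->; rewrite mulr0.
Qed.

Lemma qvec_ip i j : (i < l)%N -> (j < l)%N ->
  ip (qv i *m v) (qv j *m v) =
    if i == j then (if (i < 1)%N then 1 else -1) else 0.
Proof.
move=> il jl; have [jg _] := qE _ (qvec_q jl).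
have := trform_qvec il jl; rewrite trform_q ?qvec_q //.
by case: eqP => _; [case: ifP => _|]; lra.
Qed.

Lemma qnorm_qvec i : (i < l)%N -> qnorm (qv i) = if (i < 1)%N then 1 else -1.
Proof. by move=> il; rewrite qnorm_q ?qvec_q // qvec_ip // eqxx. Qed.

End SymmetricPair.

(** * Smoothness of polynomial functions of a matrix *)

Section PolynomialFunctions.
Variables (R : realType) (n : nat).
Local Notation M := 'M[R]_n.+1.

(** The class is stable under every ['D_v], as the recursion in [Ck_on] requires. *)
Inductive polyfun : (M -> R^o) -> Prop :=
| polyfun_cst c : polyfun (cst c)
| polyfun_coord i j : polyfun (fun u => u i j)
| polyfunD f h : polyfun f -> polyfun h -> polyfun (f + h)
| polyfunM f h : polyfun f -> polyfun h -> polyfun (f * h).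

Lemma polyfun_derivable f : polyfun f -> forall x v, derivable f x v.
Proof.
elim=> [c|i j|h1 h2 _ d1 _ d2|h1 h2 _ d1 _ d2] x v.
- exact: derivable_cst.
- by have /derivable_mxP := @derivable_id R M x v; apply.
- exact: derivableD.
- exact: derivableM.
Qed.

Lemma polyfun_continuous f : polyfun f -> continuous f.
Proof.
elim=> [c|i j|h1 h2 _ d1 _ d2|h1 h2 _ d1 _ d2] x.
- exact: cst_continuous.
- exact: coord_continuous.
- exact: cvgD (d1 x) (d2 x).
- exact: cvgM (d1 x) (d2 x).
Qed.

Lemma polyfun_derive f : polyfun f -> forall v, polyfun ('D_v f).
Proof.
elim=> [c|i j|h1 h2 p1 d1 p2 d2|h1 h2 p1 d1 p2 d2] v.
- rewrite (_ : 'D_v _ = cst 0); first exact: polyfun_cst.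
  by apply/funext => x; rewrite derive_cst.
- rewrite (_ : 'D_v _ = cst (v i j)); first exact: polyfun_cst.
  apply/funext => x; have := derive_mx (@derivable_id R M x v).
  by rewrite derive_id => /(congr1 (fun A : M => A i j)); rewrite mxE.
- rewrite (_ : 'D_v _ = 'D_v h1 + 'D_v h2); first exact: polyfunD.
  by apply/funext => x; rewrite deriveD //; exact: polyfun_derivable.
- rewrite (_ : 'D_v _ = h1 * 'D_v h2 + h2 * 'D_v h1).
    by apply: polyfunD; apply: polyfunM.
  by apply/funext => x; rewrite deriveM //; exact: polyfun_derivable.
Qed.

Lemma polyfun_Ck_on (U : set M) k f : polyfun f -> Ck_on U k f.
Proof.
elim: k f => [|k IH] f pf; split=> //; try by move=> x _; exact: polyfun_continuous.
split=> [x v _|v]; first exact: polyfun_derivable.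
exact/IH/polyfun_derive.
Qed.

Lemma polyfun_sum (I : Type) (r : seq I) (F : I -> M -> R^o) :
  (forall i, polyfun (F i)) -> polyfun (fun u => \sum_(i <- r) F i u).
Proof.
move=> pF; elim: r => [|i r IH].
  rewrite (_ : (fun _ => _) = cst 0); first exact: polyfun_cst.
  by apply/funext => u; rewrite big_nil.
rewrite (_ : (fun _ => _) = F i + (fun u => \sum_(i <- r) F i u)).
  exact: polyfunD.
by apply/funext => u; rewrite big_cons.
Qed.

Lemma polyfun_mulmx m p (A : 'M[R]_(m, n.+1)) (b : 'M[R]_(n.+1, p)) i j :
  polyfun (fun u => (A *m u *m b) i j).
Proof.
rewrite (_ : (fun _ => _) = fun u =>
    \sum_k \sum_k' ((cst (A i k' * b k j) : M -> R^o) * (fun u => u k' k)) u).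
  apply: polyfun_sum => k; apply: polyfun_sum => k'.
  by apply: polyfunM; [exact: polyfun_cst | exact: polyfun_coord].
apply/funext => u; rewrite mxE; apply: eq_bigr => k _.
by rewrite mxE mulr_suml; apply: eq_bigr => k' _; rewrite mulrAC.
Qed.

End PolynomialFunctions.

(** * The invariant metric induced on the orbit of [v] *)

Section InvariantMetric.
Variables (R : realType) (l : nat).
Hypothesis l_ge3 : (3 <= l)%N.
Local Notation M := 'M[R]_l.+1.
Local Notation g := (lieG R l).
Local Notation gr := (gram R l).
Variables (v : 'cV[R]_l.+1) (sigma theta : 'End(M)).
Hypothesis v_norm : sqnorm v = 1.
Hypothesis sigma_inv : involutive_lie_aut g sigma.
Hypothesis sigma_fix : eigsub g sigma 1 = lieH v.
Hypothesis theta_cartan : cartan_involution g theta.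
Hypothesis sigma_theta :
  {in g, forall X, sigma (theta X) = theta (sigma X)}.
Local Notation q := (eigsub g sigma (-1)).
Implicit Types (X Y Z u w : M).

Lemma G_gram u : G R l u -> u^T *m gr *m u = gr.
Proof. by move=> /connected_component_sub []. Qed.

Lemma G1 : G R l 1%:M.
Proof.
by apply: connected_component_refl; split; rewrite ?det1 // trmx1 mul1mx mulmx1.
Qed.

Lemma H1 : H v 1%:M.
Proof. by split; [exact: G1 | rewrite mul1mx]. Qed.

Lemma gram_mulVmx u : u^T *m gr *m u = gr -> gr *m u^T *m gr *m u = 1%:M.
Proof. by move=> e; rewrite -!mulmxA (mulmxA _ gr) e gramK. Qed.

Lemma G_unitmx u : G R l u -> u \in unitmx.
Proof. by move/G_gram/gram_mulVmx/mulmx1_unit => []. Qed.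

Lemma ip_G u x y : G R l u -> ip (u *m x) (u *m y) = ip x y.
Proof.
by move/G_gram => e; rewrite /ip trmx_mul !mulmxA -(mulmxA _ _ gr) -(mulmxA _ _ u) e.
Qed.

Lemma Ad_mulmx u X (x : 'cV[R]_l.+1) : u \in unitmx ->
  Ad u X *m (u *m x) = u *m (X *m x).
Proof. by move=> uu; rewrite /Ad mulmxA mulmxKV // -mulmxA. Qed.

Lemma AdVK u X : u \in unitmx -> Ad u (Ad (invmx u) X) = X.
Proof.
by move=> uu; rewrite /Ad invmxK !mulmxA mulmxV // mul1mx mulmxK.
Qed.

Lemma AdK u X : u \in unitmx -> Ad (invmx u) (Ad u X) = X.
Proof. by have := @AdVK (invmx u) X; rewrite unitmx_inv invmxK. Qed.

(** Only preservation of the form is assumed, so that this applies to [invmx u] without showing that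
    it lies in the identity component. *)
Lemma Ad_lieG u X : u^T *m gr *m u = gr -> X \in g -> Ad u X \in g.
Proof.
move=> ug Xg; have uV := gram_mulVmx ug; have [_ uu] := mulmx1_unit uV.
have -> : Ad u X = u *m X *m (gr *m u^T *m gr).
  by rewrite /Ad -[invmx u]mul1mx -uV mulmxK.
apply: memlieG; rewrite !trmx_mul trmxK tr_gram (lieGE Xg).
by rewrite !(mulmxN, mulNmx) !mulmxA -!(mulmxA _ gr gr) !gramK !mulmx1.
Qed.

Lemma invmx_gram u : u^T *m gr *m u = gr -> (invmx u)^T *m gr *m invmx u = gr.
Proof.
move=> e; have [_ uu] := mulmx1_unit (gram_mulVmx e).
rewrite -{1}e !mulmxA -trmx_mul mulmxV // trmx1 mul1mx mulmxK //.
Qed.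

(** This makes the map from cosets to the orbit of [v] well defined. *)
Lemma lcoset_rep u w : lcoset v u w -> w *m v = u *m v.
Proof. by case=> h [_ hv] <-; rewrite -mulmxA hv. Qed.

(* The translate by u of the form X, Y |-> <X v, Y v>: in an arbitrary
   representative u of the coset, <u^-1 X u v, u^-1 Y u v> = <X u v, Y u v>. *)
Definition sphere_metric (S : set M) X Y : R :=
  ip (X *m (xget 1%:M S *m v)) (Y *m (xget 1%:M S *m v)).

Lemma sphere_metricE u X Y :
  sphere_metric (lcoset v u) X Y = ip (X *m (u *m v)) (Y *m (u *m v)).
Proof.
(* The coset is nonempty, so [xget] returns a representative and not its default [1%:M]. *)
rewrite /sphere_metric; have : lcoset v u u.
  by exists 1%:M; [exact: H1 | rewrite mulmx1].
by move=> /(xgetI 1%:M)/lcoset_rep ->.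
Qed.

Lemma sphere_metric_invariant : invariant_metric v q sphere_metric.
Proof.
split.
- move=> u _ X Y Z _ _ _ c; rewrite !sphere_metricE mulmxDl -scalemxAl.
  by rewrite ipDl ipZl.
- by move=> u _ X Y _ _; rewrite !sphere_metricE ipC.
- move=> u Gu X Y; rewrite lieHP => /andP[_ /eqP Xv] _.
  by rewrite sphere_metricE Ad_mulmx ?G_unitmx // Xv mulmx0 ip0l.
(* The pull-back to [G] is the restriction of a quadratic polynomial on all matrices, so one global
   extension serves near every point. *)
- move=> X Y _ _ u Gu; exists setT; exists (fun w => ip (X *m (w *m v)) (Y *m (w *m v))).
  split=> //; [exact: openT| |by move=> w _ _; rewrite sphere_metricE].
  move=> k; apply: polyfun_Ck_on.
  rewrite (_ : (fun _ => _) = fun w => \sum_(i < l.+1)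
     (cst (if (i < 2)%N then 1 else -1) * ((fun w => (X *m w *m v) i 0) *
        (fun w => (Y *m w *m v) i 0) : M -> R^o)) w).
    apply: polyfun_sum => i; apply: polyfunM; first exact: polyfun_cst.
    by apply: polyfunM; exact: polyfun_mulmx.
  by apply/funext => w; rewrite ipE !mulmxA.
- move=> w u Gw Gu X Y _ _; rewrite !sphere_metricE -(mulmxA w).
  by rewrite !Ad_mulmx ?ip_G ?G_unitmx.
- move=> X Xq; rewrite sphere_metricE mul1mx.
  by rewrite (qnorm_q l_ge3 v_norm sigma_inv sigma_fix theta_cartan sigma_theta).
Qed.

(** * Uniqueness of the invariant metric *)

Definition qproj X := 2^-1 *: (X - sigma X).

Lemma qproj_q X : X \in g -> qproj X \in q.
Proof.
move=> Xg; have sg := sigma_lieG sigma_inv Xg; apply/qE; split.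
  by rewrite rpredZ // rpredB.
by rewrite /qproj linearZ linearB /= (sigmaK sigma_inv) // -scalerN opprB.
Qed.

Lemma sub_qproj_lieH X : X \in g -> X - qproj X \in lieH v.
Proof.
move=> Xg; have sg := sigma_lieG sigma_inv Xg.
have -> : X - qproj X = 2^-1 *: (X + sigma X).
  apply: (@scalerI _ _ 2); first by rewrite pnatr_eq0.
  rewrite scalerBr /qproj !scalerA mulfV ?pnatr_eq0 // !scale1r.
  by rewrite scaler_nat mulr2n opprB addrA addrAC addrK.
apply/(lieHE sigma_fix); split; first by rewrite rpredZ // rpredD.
by rewrite linearZ linearD /= (sigmaK sigma_inv) // addrC.
Qed.

(** At the base coset the radical contains [lieH v], and [X] differs from its projection to [q] by
    an element of it. *)
Lemma invariant_metric_qproj m X Y :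
    invariant_metric v q m -> X \in g -> Y \in g ->
  m (lcoset v 1%:M) X Y = m (lcoset v 1%:M) (qproj X) (qproj Y).
Proof.
move=> [lin sym desc _ _ _] Xg Yg.
have red A B : A \in g -> B \in g ->
    m (lcoset v 1%:M) A B = m (lcoset v 1%:M) (qproj A) B.
  move=> Ag Bg; have [Pg _] := qE _ _ (qproj_q Ag).
  have Ah := sub_qproj_lieH Ag; have [hg _] := lieHE sigma_fix _ Ah.
  have := lin _ G1 _ _ _ hg Pg Bg 1; rewrite scale1r subrK => ->.
  have := desc _ G1 _ _ Ah Bg; rewrite /Ad invmx1 mul1mx mulmx1 => ->.
  by rewrite mulr0 add0r.
have [PX _] := qE _ _ (qproj_q Xg); have [PY _] := qE _ _ (qproj_q Yg).
by rewrite red // (sym _ G1) // red // (sym _ G1).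
Qed.

Lemma invariant_metric_polar m X Y :
    invariant_metric v q m -> X \in q -> Y \in q ->
  m (lcoset v 1%:M) X Y = 2^-1 * (qnorm (X + Y) - qnorm X - qnorm Y).
Proof.
move=> [lin sym _ _ _ base] Xq Yq; have [Xg _] := qE _ _ Xq; have [Yg _] := qE _ _ Yq.
rewrite -!base ?rpredD //.
have add A B C : A \in g -> B \in g -> C \in g -> m (lcoset v 1%:M) (A + B) C
    = m (lcoset v 1%:M) A C + m (lcoset v 1%:M) B C.
  by move=> Ag Bg Cg; have := lin _ G1 _ _ _ Ag Bg Cg 1; rewrite scale1r mul1r.
have XYg : X + Y \in g by rewrite rpredD.
rewrite add // (sym _ G1 _ _ Xg XYg) (sym _ G1 _ _ Yg XYg) !add //.
by rewrite (sym _ G1 _ _ Yg Xg); field.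
Qed.

(** Invariance reduces to the base coset and projection to [q]; there polarization recovers the form
    from [qnorm]. *)
Lemma invariant_metric_unique m m' :
    invariant_metric v q m -> invariant_metric v q m' ->
  forall u, G R l u -> {in g &, forall X Y,
    m' (lcoset v u) X Y = m (lcoset v u) X Y}.
Proof.
move=> im im' u Gu X Y Xg Yg; have uu := G_unitmx Gu.
have red k : invariant_metric v q k -> k (lcoset v u) X Y
    = k (lcoset v 1%:M) (Ad (invmx u) X) (Ad (invmx u) Y).
  move=> ik; have AVg Z : Z \in g -> Ad (invmx u) Z \in g.
    by apply: Ad_lieG; apply/invmx_gram/G_gram.
  (* The translation goes from the base coset to that of [u], so that only [u], and not [invmx u],
     has to lie in [G]. *)
  have := im_invariant ik Gu G1 (AVg _ Xg) (AVg _ Yg).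
  by rewrite mulmx1 !AdVK.
have AVg Z : Z \in g -> Ad (invmx u) Z \in g.
  by apply: Ad_lieG; apply/invmx_gram/G_gram.
rewrite !red // !(invariant_metric_qproj _ (AVg _ Xg) (AVg _ Yg)) //.
by rewrite !invariant_metric_polar // qproj_q // AVg.
Qed.

End InvariantMetric.

(** * The signature of the orbit metric *)

Section Signature.
Variables (R : realType) (l : nat).
Local Notation M := 'M[R]_l.+1.
Local Notation g := (lieG R l).
Variables (v : 'cV[R]_l.+1) (f : nat -> M).
Hypothesis l_gt0 : (0 < l)%N.
Hypothesis v_norm : sqnorm v = 1.
Hypothesis f_g : forall i, (i < l)%N -> f i \in g.
Hypothesis f_ip : forall i j, (i < l)%N -> (j < l)%N ->
  ip (f i *m v) (f j *m v) =
    if i == j then (if (i < 1)%N then 1 else -1) else 0.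

(** Evaluation at [v] has kernel [lieH v] on [g]; its image is orthogonal to [v], hence meets the
    line of [v] trivially and has dimension at most l. *)
Lemma dim_lieG_le : (\dim g <= \dim (lieH v) + l)%N.
Proof.
pose h : 'Hom(M, 'cV[R]_l.+1) := linfun (mulmxr v : M -> 'cV[R]_l.+1).
rewrite -(limg_ker_dim h g) leq_add2l -ltnS.
have v0 : v != 0.
  by apply: contra_eq_neq v_norm => ->; rewrite -ip_sqnorm ip0l eq_sym oner_eq0.
have cap0 : (h @: g :&: <[v]> = 0)%VS.
  apply/eqP; rewrite -subv0; apply/subvP => x; rewrite memv_cap memv0.
  case/andP => /memv_imgP[X Xg ->] /vlineP[c]; rewrite lfunE /= => e.
  have := ip_lieG_self v Xg; rewrite e ipZr ip_sqnorm v_norm mulr1 => ->.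
  by rewrite scale0r.
have := dimvS (subvf (h @: g + <[v]>)%VS).
by rewrite dimv_disjoint_sum // dim_vline v0 addn1 dimvf /dim /= muln1.
Qed.

Lemma sphere_metric_lorentzian : lorentzian v (sphere_metric v).
Proof.
move=> u Gu; have uu := G_unitmx Gu.
have N_l : (1 + (l - 1) = l)%N by rewrite subnKC.
pose e := [tuple Ad u (f (i : 'I_(1 + (l - 1)))) | i < 1 + (l - 1)].
have eE (i : 'I_(1 + (l - 1))) : e`_i = Ad u (f i) by rewrite -tnth_nth tnth_mktuple.
have lt_l (i : 'I_(1 + (l - 1))) : (i < l)%N by rewrite -[X in (_ < X)%N]N_l.
(* Pairing with the j-th orthonormal vector isolates [c j]. This gives both freeness and trivial
   intersection with the stabilizer algebra, which kills [u *m v]. *)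
have coef0 (c : 'I_(1 + (l - 1)) -> R) :
    (\sum_i c i *: e`_i) *m (u *m v) = 0 -> forall i, c i = 0.
  move=> c0 j; have : ip ((\sum_i c i *: e`_i) *m (u *m v)) (u *m (f j *m v)) = 0.
    by rewrite c0 ip0l.
  rewrite mulmx_suml ip_suml (bigD1 j) //= big1 => [|i ij].
    rewrite addr0 -scalemxAl ipZl eE Ad_mulmx // ip_G // f_ip // eqxx.
    by case: ifP => _ /eqP; rewrite mulf_eq0 ?oppr_eq0 oner_eq0 orbF => /eqP.
  rewrite -scalemxAl ipZl eE Ad_mulmx // ip_G // f_ip //.
  by rewrite (inj_eq val_inj) (negbTE ij) mulr0.
have free_e : free e by apply/freeP => c c0; apply: coef0; rewrite c0 mul0mx.
have Adk Y : Y \in lieH v -> Ad u Y *m (u *m v) = 0.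
  by rewrite lieHP Ad_mulmx // => /andP[_ /eqP ->]; rewrite mulmx0.
have cap0 : (<<e>> :&: linfun (Ad u) @: lieH v = 0)%VS.
  apply/eqP; rewrite -subv0; apply/subvP => Z; rewrite memv_cap memv0.
  case/andP => Ze /memv_imgP[Y Yh]; rewrite lfunE /= => ZE.
  have := Adk _ Yh; rewrite -ZE (coord_span Ze) => /coef0 c0.
  by rewrite big1 // => i _; rewrite c0 scale0r.
exists e; split=> //.
(* The sum is contained in [g] and direct, so its dimension is l + dim [lieH v], an upper bound for
   dim [g]. *)
- apply/eqP; rewrite eqEdim; apply/andP; split.
    rewrite subv_add; apply/andP; split.
      apply/span_subvP => Z /tnthP[i ->]; rewrite tnth_mktuple.
      by apply: Ad_lieG (f_g (lt_l i)); exact: G_gram.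
    apply/subvP => Z /memv_imgP[Y Yh ->]; rewrite lfunE /=.
    by apply: Ad_lieG; [exact: G_gram | move: Yh; rewrite lieHP => /andP[]].
  rewrite dimv_disjoint_sum // limg_dim_eq.
    move: free_e; rewrite /free size_tuple => /eqP ->.
    by rewrite N_l addnC dim_lieG_le.
  apply/eqP; rewrite -subv0; apply/subvP => Z; rewrite memv_cap memv_ker lfunE /=.
  case/andP => _ /eqP AZ; have := AdK Z uu.
  by rewrite AZ linear0 memv0 => ->. 
- move=> i j; rewrite sphere_metricE !eE !Ad_mulmx // ip_G // f_ip //.
Qed.

End Signature.

Theorem proposition35 (R : realType) (l : nat) (l_ge3 : (3 <= l)%N)
    (v : 'cV[R]_l.+1) (v_norm : sqnorm v = 1)
    (sigma theta : 'End('M[R]_l.+1))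
    (sigma_inv : involutive_lie_aut (lieG R l) sigma)
    (sigma_fix : eigsub (lieG R l) sigma 1 = lieH v)
    (theta_cartan : cartan_involution (lieG R l) theta)
    (sigma_theta : {in lieG R l, forall X, sigma (theta X) = theta (sigma X)})
    (q : {vspace 'M[R]_l.+1}) (q_def : q = eigsub (lieG R l) sigma (-1))
    (p : {vspace 'M[R]_l.+1}) (p_def : p = eigsub (lieG R l) theta (-1))
    (a : {vspace 'M[R]_l.+1}) (a_max : maximal_abelian_in p a)
    (J1 J2 : 'M[R]_l.+1) (J_basis : basis_of a [:: J1; J2])
    (J1_h : J1 \in lieH v) (J2_q : J2 \in q)
    (roots : forall x y : R, (x, y) != (0, 0) ->
      \dim (rootspace (lieG R l) J1 J2 x y) = root_mult l x y)
    (Xpp : 'M[R]_l.+1) (Xpp_root : Xpp \in rootspace (lieG R l) J1 J2 1 1)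
    (Xpp_norm : lie (theta Xpp) Xpp = 4 *: (J1 + J2))
    (X0p : nat -> 'M[R]_l.+1)
    (X0p_basis : basis_of (rootspace (lieG R l) J1 J2 0 1)
      [seq X0p k | k <- iota 3%N (l - 3)%N])
    (X0p_norm : forall k, (3 <= k <= l - 1)%N ->
      lie (theta (X0p k)) (X0p k) = 2 *: J2)
    (X0p_orth : forall j k, (3 <= j <= l - 1)%N -> (3 <= k <= l - 1)%N ->
      j != k -> killing (lieG R l) (X0p j) (theta (X0p k)) = 0) :
  qnorm (qvec sigma theta J1 J2 Xpp X0p 0%N) = 1 /\
  (forall i, (1 <= i <= l - 1)%N ->
    qnorm (qvec sigma theta J1 J2 Xpp X0p i) = -1) /\
  exists m : set 'M[R]_l.+1 -> 'M[R]_l.+1 -> 'M[R]_l.+1 -> R,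
    [/\ invariant_metric v q m,
        forall m', invariant_metric v q m' -> forall u, G R l u ->
          {in lieG R l &, forall X Y, m' (lcoset v u) X Y = m (lcoset v u) X Y}
      & lorentzian v m].
Proof.
subst q p.
have [a_p a_abel _] := a_max.
have J1a : J1 \in a by rewrite (basis_mem J_basis) // mem_head.
have J2a : J2 \in a by rewrite (basis_mem J_basis) // inE mem_head orbT.
have tJ1 : theta J1 = - J1.
  by have /eigsubP[_] := subvP a_p _ J1a; rewrite scaleN1r.
have tJ2 : theta J2 = - J2.
  by have /eigsubP[_] := subvP a_p _ J2a; rewrite scaleN1r.
have J2J1 : lie J2 J1 = 0 by exact: a_abel.
have J1J2 : lie J1 J2 = 0 by exact: a_abel.
have /rootspaceP[Xg] := Xpp_root; rewrite !scale1r => X1 X2.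
(* Otherwise the normalization gives [J1 = - J2], against freeness of the basis of [a]. *)
have X0 : Xpp != 0.
  apply/eqP => X0; move: Xpp_norm; rewrite X0 linear0 => /esym/eqP.
  rewrite scaler_eq0 pnatr_eq0 /= addr_eq0 => /eqP J12.
  have := basis_free J_basis; rewrite free_cons => /andP[/negP[]].
  by rewrite J12 rpredN memv_span ?mem_head.
have X0pP k : (3 <= k <= l - 1)%N -> [/\ X0p k \in lieG R l,
    lie J1 (X0p k) = 0 & lie J2 (X0p k) = X0p k].
  (* The list [iota 3 (l - 3)] runs exactly over 3 <= k <= l - 1. *)
  move=> kl; have /rootspaceP[] : X0p k \in rootspace (lieG R l) J1 J2 0 1.
    apply: (basis_mem X0p_basis); apply: map_f; rewrite mem_iota; lia.
  by rewrite scale0r scale1r.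
pose F := qvec sigma theta J1 J2 Xpp X0p.
have F_q k : (k < l)%N -> F k \in eigsub (lieG R l) sigma (-1).
  exact: (qvec_q l_ge3 v_norm sigma_inv sigma_fix theta_cartan sigma_theta
    J1_h J2_q tJ1 tJ2 Xg X1 X2 Xpp_norm X0 X0pP).
have F_norm k : (k < l)%N -> qnorm (F k) = if (k < 1)%N then 1 else -1.
  exact: (qnorm_qvec l_ge3 v_norm sigma_inv sigma_fix theta_cartan sigma_theta
    J1_h J2_q tJ1 tJ2 J2J1 Xg X1 X2 Xpp_norm X0 X0pP X0p_norm X0p_orth).
have l_gt0 : (0 < l)%N by exact: leq_trans l_ge3.
have sphere_inv : invariant_metric v (eigsub (lieG R l) sigma (-1))
    (sphere_metric v).
  exact: (sphere_metric_invariant l_ge3 v_norm sigma_inv sigma_fix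
    theta_cartan sigma_theta).
split; first exact: (F_norm 0%N).
split=> [i /andP[i_gt0 il]|].
  by rewrite -/F F_norm; [rewrite ltnNge i_gt0 | lia].
exists (sphere_metric v); split=> //.
  by move=> m' m'_inv; exact: (invariant_metric_unique sigma_inv sigma_fix).
apply: (@sphere_metric_lorentzian _ _ _ F) => //.
  by move=> i /F_q/eigsubP[].
exact: (qvec_ip l_ge3 v_norm sigma_inv sigma_fix theta_cartan sigma_theta
  J1_h J2_q tJ1 tJ2 J2J1 Xg X1 X2 Xpp_norm X0 X0pP X0p_norm X0p_orth).
Qed.
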